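(* Let $A$ be a Schreier domain and $M$ an integrally closed PS module over $A$. Then $M[X]:=M\otimes_A A[X]$ is a PS module over the polynomial ring $A[X]$.
   Context: All rings are commutative and unitary. For an integral domain $A$, a torsion-free $A$-module $M$ is a PS module (pre-Schreier module) if every equality $ax=by$ with $a,b\in A-\{0\}$ and $x,y\in M-\{0\}$ has a refinement, i.e. there exist $c,d,e\in A$ and $z\in M$ with $a=ce$, $b=cd$, $x=dz$, $y=ez$. $A$ is a PS domain if it is a PS module over itself; a Schreier domain is an integrally closed PS domain. Let $K$ be the quotient field of $A$. A torsion-free $A$-module $M$ (viewed inside $K\otimes_A M$) is called integrally closed if $M=\bigcap\{VM \mid V \text{ a valuation overring of } A\}$, where a valuation overring of $A$ is a valuation ring $V$ with $A\subseteq V\subseteq K$, and $VM$ is the $V$-submodule of $K\otimes_A M$ generated by $M$. *)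

(* Defs.v *)
From HB Require Import structures.
From mathcomp Require Import all_boot all_algebra.
From mathcomp Require Import generic_quotient ring_quotient fraction mxpoly.
From mathcomp Require Import boolp.
From mathcomp Require Import freeg.

Set Implicit Arguments.
Unset Strict Implicit.
Unset Printing Implicit Defensive.

Import GRing.Theory.

Local Open Scope ring_scope.
Local Open Scope quotient_scope.

(* The tensor product M ⊗_A B, where the commutative ring B is an A-algebra
   through f : A -> B: the free abelian group on M × B modulo the subgroup
   generated by the bilinearity relations, with B acting on the right factor. *)
Section Tensor.

Variables (A B : comNzRingType) (f : {rmorphism A -> B}) (M : lmodType A).

Local Notation F := {freeg (M * B)%type}.

Inductive tensor_rel : F -> Prop :=
| TensorRel0 : tensor_rel 0
| TensorRelB u v : tensor_rel u -> tensor_rel v -> tensor_rel (u - v)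
| TensorRelDl x y b :
    tensor_rel (<< (x + y, b) >> - << (x, b) >> - << (y, b) >>)
| TensorRelDr x b c :
    tensor_rel (<< (x, b + c) >> - << (x, b) >> - << (x, c) >>)
| TensorRelZ a x b : tensor_rel (<< (a *: x, b) >> - << (x, f a * b) >>).

Definition tensor_relb : {pred F} := fun u => `[< tensor_rel u >].

Lemma tensor_relb_closed : zmod_closed tensor_relb.
Proof.
split; first by apply/asboolP; exact: TensorRel0.
by move=> u v /asboolP hu /asboolP hv; apply/asboolP; exact: TensorRelB.
Qed.

HB.instance Definition _ :=
  GRing.isZmodClosed.Build F tensor_relb tensor_relb_closed.

Definition tensor : Type := Quotient.quot tensor_relb.

HB.instance Definition _ := GRing.Zmodule.on tensor.

Definition tensor_pi (u : F) : tensor := \pi_(Quotient.quot tensor_relb) u.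

Lemma tensor_pi_is_zmod_morphism : zmod_morphism tensor_pi.
Proof. exact: (raddfB \pi_(Quotient.quot tensor_relb)). Qed.

HB.instance Definition _ :=
  GRing.isZmodMorphism.Build F tensor tensor_pi tensor_pi_is_zmod_morphism.

Lemma tensor_piP u v : tensor_pi u = tensor_pi v <-> tensor_rel (u - v).
Proof.
have e := Quotient.idealrBE tensor_relb u v.
split=> [/eqP h|h]; first by apply/asboolP; move: h; rewrite /tensor_pi -e.
by apply/eqP; rewrite /tensor_pi -e; apply/asboolP.
Qed.

Lemma tensor_piK (t : tensor) : tensor_pi (repr t) = t.
Proof. exact: reprK. Qed.

Definition tens (x : M) (b : B) : tensor := tensor_pi << (x, b) >>.

Lemma tensDl x y b : tens (x + y) b = tens x b + tens y b.
Proof.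
rewrite /tens -raddfD; apply/tensor_piP.
by rewrite opprD addrA; exact: TensorRelDl.
Qed.

Lemma tensDr x b c : tens x (b + c) = tens x b + tens x c.
Proof.
rewrite /tens -raddfD; apply/tensor_piP.
by rewrite opprD addrA; exact: TensorRelDr.
Qed.

Lemma tensZ a x b : tens (a *: x) b = tens x (f a * b).
Proof. by apply/tensor_piP; exact: TensorRelZ. Qed.

Definition free_act (b : B) (u : F) : F :=
  fglift (fun p : M * B => << (p.1, b * p.2) >> : F) u.

Lemma free_act_is_zmod_morphism b : zmod_morphism (free_act b).
Proof. exact: lift_is_additive. Qed.

HB.instance Definition _ b :=
  GRing.isZmodMorphism.Build F F (free_act b) (free_act_is_zmod_morphism b).

Lemma free_actU b x c : free_act b << (x, c) >> = << (x, b * c) >>.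
Proof. by rewrite /free_act liftU scale1r. Qed.

Lemma free_act_rel b u : tensor_rel u -> tensor_rel (free_act b u).
Proof.
elim=> [|v w _ hv _ hw|x y c|x c d|a x c].
- by rewrite raddf0; exact: TensorRel0.
- by rewrite raddfB; exact: TensorRelB.
- by rewrite !raddfB /= !free_actU; exact: TensorRelDl.
- by rewrite !raddfB /= !free_actU mulrDr; exact: TensorRelDr.
- by rewrite raddfB /= !free_actU mulrCA; exact: TensorRelZ.
Qed.

Definition tensor_scale (b : B) (t : tensor) : tensor :=
  tensor_pi (free_act b (repr t)).

Lemma tensor_scale_pi b u :
  tensor_scale b (tensor_pi u) = tensor_pi (free_act b u).
Proof.
apply/tensor_piP; rewrite -raddfB; apply: free_act_rel.
by apply/tensor_piP; rewrite tensor_piK.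
Qed.

Lemma tensor_scale_tens b x c : tensor_scale b (tens x c) = tens x (b * c).
Proof. by rewrite tensor_scale_pi free_actU. Qed.

Lemma tensor_ind (P : tensor -> Prop) :
  P 0 -> (forall s t, P s -> P t -> P (s + t)) -> (forall x b, P (tens x b)) ->
  forall t, P t.
Proof.
move=> P0 PD Pt t.
have PN x b : P (- tens x b).
  have -> : - tens x b = tens (- x) b; last exact: Pt.
  apply/eqP; rewrite eq_sym -addr_eq0 -tensDl addNr.
  by rewrite -(addrK (tens 0 b) (tens 0 b)) -tensDl addr0 subrr.
have Pn (s : tensor) n : P s -> P (s *+ n).
  by move=> Ps; elim: n => [|n ih]; rewrite ?mulr0n // mulrS; exact: PD.
rewrite -[t]tensor_piK -[repr t]freeg_sumE raddf_sum.
elim/big_rec: _ => // -[x b] u _ Pu; apply: PD => //.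
move: (coeff _ _) => k.
have -> : << k *g (x, b) >> = << (x, b) >> *~ k :> F.
  by rewrite freegU_mulz intz.
rewrite raddfMz; case: k => n; first by rewrite -pmulrn; apply: Pn; exact: Pt.
by rewrite NegzE mulrNz -mulNrz -pmulrn; apply: Pn; exact: PN.
Qed.

Lemma tensor_scaleDr b : {morph tensor_scale b : s t / s + t}.
Proof.
move=> s t; rewrite -[s]tensor_piK -[t]tensor_piK -raddfD !tensor_scale_pi.
by rewrite !raddfD.
Qed.

Lemma tensor_scale0 b : tensor_scale b 0 = 0.
Proof. by rewrite -(raddf0 tensor_pi) tensor_scale_pi !raddf0. Qed.

Lemma tensor_scaleA b c t :
  tensor_scale b (tensor_scale c t) = tensor_scale (b * c) t.
Proof.
elim/tensor_ind: t => [|s t hs ht|x d]; first by rewrite !tensor_scale0.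
  by rewrite !tensor_scaleDr hs ht.
by rewrite !tensor_scale_tens mulrA.
Qed.

Lemma tensor_scale1 : left_id 1 tensor_scale.
Proof.
move=> t; elim/tensor_ind: t => [|s t hs ht|x d]; first exact: tensor_scale0.
  by rewrite tensor_scaleDr hs ht.
by rewrite tensor_scale_tens mul1r.
Qed.

Lemma tensor_scaleDl t : {morph tensor_scale^~ t : b c / b + c}.
Proof.
move=> b c /=; elim/tensor_ind: t => [|s t hs ht|x d].
- by rewrite !tensor_scale0 addr0.
- by rewrite !tensor_scaleDr hs ht addrACA.
- by rewrite !tensor_scale_tens mulrDl tensDr.
Qed.

HB.instance Definition _ := GRing.Zmodule_isLmodule.Build B tensor
  tensor_scaleA tensor_scale1 tensor_scaleDr tensor_scaleDl.

Lemma scale_tens b x c : b *: tens x c = tens x (b * c).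
Proof. exact: tensor_scale_tens. Qed.

Lemma tensor_lift (P : zmodType) (g : M -> B -> P) :
  (forall x y b, g (x + y) b = g x b + g y b) ->
  (forall x b c, g x (b + c) = g x b + g x c) ->
  (forall a x b, g (a *: x) b = g x (f a * b)) ->
  exists h : {additive tensor -> P}, forall x b, h (tens x b) = g x b.
Proof.
move=> gDl gDr gZ.
pose h0 (u : F) : P := fglift (fun p : M * B => g p.1 p.2 : zmodule P) u.
have h0B : zmod_morphism h0.
  exact: (@lift_is_additive _ _ (zmodule P) (fun p : M * B => g p.1 p.2)).
pose H0 : {additive F -> P} :=
  HB.pack h0 (GRing.isZmodMorphism.Build F P h0 h0B).
have H0U x b : H0 << (x, b) >> = g x b.
  by rewrite /= /h0 liftU scale1r.
have H0rel u : tensor_rel u -> H0 u = 0.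
  elim=> [|v w _ hv _ hw|x y c|x c d|a x c].
  - exact: raddf0.
  - by rewrite raddfB hv hw subr0.
  - by rewrite !raddfB !H0U gDl addrAC addrK subrr.
  - by rewrite !raddfB !H0U gDr addrAC addrK subrr.
  - by rewrite raddfB !H0U gZ subrr.
have H0pi u v : tensor_pi u = tensor_pi v -> H0 u = H0 v.
  by move=> /tensor_piP /H0rel; rewrite raddfB => /eqP; rewrite subr_eq0 => /eqP.
pose h (t : tensor) : P := H0 (repr t).
have hB : zmod_morphism h.
  by move=> s t; rewrite /h -(raddfB H0); apply: H0pi;
  rewrite tensor_piK [RHS]raddfB /= !tensor_piK.
pose H : {additive tensor -> P} :=
  HB.pack h (GRing.isZmodMorphism.Build tensor P h hB).
exists H.
by move=> x b /=; rewrite /h -H0U; apply: H0pi; rewrite tensor_piK.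
Qed.

End Tensor.

Definition torsion_free (A : idomainType) (M : lmodType A) : Prop :=
  forall (a : A) (x : M), a *: x = 0 -> a = 0 \/ x = 0.

Definition PS_module (A : idomainType) (M : lmodType A) : Prop :=
  torsion_free M /\
  forall (a b : A) (x y : M),
    a != 0 -> b != 0 -> x != 0 -> y != 0 -> a *: x = b *: y ->
    exists (c d e : A) (z : M),
      [/\ a = c * e, b = c * d, x = d *: z & y = e *: z].

Definition PS_domain (A : idomainType) : Prop := PS_module (A^o : lmodType A).

Definition integrally_closed_domain (A : idomainType) : Prop :=
  forall u : {fraction A},
    integralOver (@FracField.tofrac A) u -> exists a : A, u = FracField.tofrac a.

Definition Schreier_domain (A : idomainType) : Prop :=
  integrally_closed_domain A /\ PS_domain A.

(* As A is contained in V, the field {fraction A} is the quotient field of V. *)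
Record valuation_overring (A : idomainType) (V : {fraction A} -> Prop) : Prop :=
  ValuationOverring {
    overring_base : forall a : A, V (FracField.tofrac a);
    overringB : forall u v, V u -> V v -> V (u - v);
    overringM : forall u v, V u -> V v -> V (u * v);
    overring_valuation : forall u, u != 0 -> V u \/ V u^-1
  }.

(* K ⊗_A M, written with the factors in the other order *)
Definition frac_tensor (A : idomainType) (M : lmodType A) :
  lmodType {fraction A} := tensor (@FracField.tofrac A) M.

Definition to_frac_tensor (A : idomainType) (M : lmodType A) (x : M) :
  frac_tensor M := tens (@FracField.tofrac A) x 1.

(* VM: the V-submodule of K ⊗_A M generated by the image of M *)
Inductive overring_span (A : idomainType) (M : lmodType A)
    (V : {fraction A} -> Prop) : frac_tensor M -> Prop :=
| OverringSpan0 : overring_span V 0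
| OverringSpanD s t :
    overring_span V s -> overring_span V t -> overring_span V (s + t)
| OverringSpanZ v t : V v -> overring_span V t -> overring_span V (v *: t)
| OverringSpanM x : overring_span V (to_frac_tensor x).

Definition integrally_closed_module (A : idomainType) (M : lmodType A) : Prop :=
  torsion_free M /\
  forall t : frac_tensor M,
    (exists x : M, t = to_frac_tensor x) <->
    (forall V, valuation_overring V -> overring_span V t).

(* M[X] = M ⊗_A A[X] *)
Definition poly_module (A : idomainType) (M : lmodType A) :
  lmodType {poly A} := tensor (@polyC A) M.

(* Main.v *)
Require Import Defs.
From mathcomp Require Import all_boot all_algebra.
From mathcomp Require Import generic_quotient fraction mxpoly.
From mathcomp Require Import boolp freeg.

Set Implicit Arguments.
Unset Strict Implicit.
Unset Printing Implicit Defensive.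

Import GRing.Theory.

Local Open Scope ring_scope.

(* Let f x = g y. Dividing by the gcd over the quotient field K and clearing
   denominators gives s f = f' h, s g = g' h and u f' + v g' = r with s, r in
   A - {0}, so that w = u y + v x satisfies f' w = r y and g' w = r x. Since A
   and M are integrally closed, contents behave as in Gauss' lemma: for every
   coefficient p of f' or g', s divides p h_i and p w_k lies in r M. The PS
   property interpolates: some nonzero l in A divides every such p, while
   s divides l h_i and l w_k lies in r M. Then c = l h / s, e = f' / l,
   d = g' / l and z = l w / r form a refinement. *)

(** * Coefficients of products, and Gauss' lemma *)

(** This is the degree [l] coefficient of (sum q_i X^i)(sum z_k X^k), cut at i < m and k < n. The
    explicit bounds let an induction drop the top terms one at a time. *)
Definition conv (K : comNzRingType) (W : lmodType K) (q : nat -> K)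
    (z : nat -> W) (m n l : nat) : W :=
  \sum_(i < m) \sum_(k < n) (if (i + k == l)%N then q i *: z k else 0).

Section Gauss.

Variables (K : comNzRingType) (W : lmodType K).
Variables (V : K -> Prop) (N : W -> Prop).
Hypothesis N0 : N 0.
Hypothesis NB : forall s t, N s -> N t -> N (s - t).
Hypothesis NZ : forall v t, V v -> N t -> N (v *: t).

Let ND s t : N s -> N t -> N (s + t).
Proof.
by move=> Ns Nt; rewrite -[t]opprK; apply: NB => //; rewrite -sub0r; exact: NB.
Qed.

Let Nsum (n : nat) (F : 'I_n -> W) : (forall i, N (F i)) -> N (\sum_i F i).
Proof. by move=> NF; elim/big_ind: _ => //; exact: ND. Qed.

Let NZif (c : bool) v t : V v -> N t -> N (if c then v *: t else 0).
Proof. by case: c => // *; exact: NZ. Qed.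

Lemma conv_recl (q : nat -> K) (z : nat -> W) m n l :
  conv q z m.+1 n l =
  conv q z m n l + \sum_(k < n) (if (m + k == l)%N then q m *: z k else 0).
Proof. by rewrite /conv big_ord_recr. Qed.

Lemma conv_recr (q : nat -> K) (z : nat -> W) m n l :
  conv q z m n.+1 l =
  conv q z m n l + \sum_(i < m) (if (i + n == l)%N then q i *: z n else 0).
Proof.
by rewrite /conv -big_split; apply: eq_bigr => i _; rewrite big_ord_recr.
Qed.

Lemma conv_top (q : nat -> K) (z : nat -> W) m n :
  conv q z m.+1 n.+1 (m + n) = q m *: z n.
Proof.
rewrite conv_recl big_ord_recr /= eqxx /conv big1 ?add0r => [|i _].
  rewrite big1 ?add0r // => k _.
  by rewrite eqn_add2l ltn_eqF.
rewrite big1 // => k _; rewrite ltn_eqF //.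
by rewrite -addSn leq_add // -ltnS.
Qed.

Lemma conv_scaler (q : nat -> K) (z : nat -> W) a m n l :
  conv q (fun k => a *: z k) m n l = a *: conv q z m n l.
Proof.
rewrite /conv scaler_sumr; apply: eq_bigr => i _.
rewrite scaler_sumr; apply: eq_bigr => k _.
by case: ifP; rewrite ?scaler0 // !scalerA mulrC.
Qed.

(* If a is the top coefficient of q and b that of z, then a b is in N, so the
   induction on the size of z applies to a z; hence a z is in N and the top
   term of q may be dropped, until it is the unit coefficient. *)
Lemma gauss_unit_coef (q : nat -> K) (j m n : nat) (z : nat -> W) :
  (forall i, V (q i)) -> q j = 1 -> (j < m)%N ->
  (forall l, N (conv q z m n l)) -> forall k, (k < n)%N -> N (z k).
Proof.
move=> Vq qj; elim: n m z => [//|n IHn] m; elim: m => [//|m IHm] z jm Nqz.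
have Nazn : N (q m *: z n) by rewrite -conv_top.
have Naz k : (k < n.+1)%N -> N (q m *: z k).
  rewrite ltnS leq_eqVlt => /orP[/eqP-> //|].
  apply: (IHn m.+1 (fun k => q m *: z k)) => // l.
  have -> : conv q (fun k => q m *: z k) m.+1 n l =
      q m *: conv q z m.+1 n.+1 l -
      \sum_(i < m.+1) (if (i + n == l)%N then q i *: (q m *: z n) else 0).
    by rewrite -conv_scaler conv_recr addrK.
  by apply: NB; [exact: NZ | apply: Nsum => i; exact: NZif].
move: jm; rewrite ltnS leq_eqVlt => /orP[/eqP jm|jm] k kn.
  by move: (Naz _ kn); rewrite -jm qj scale1r.
apply: IHm => // l; have := Nqz l; rewrite conv_recl => Nl.
rewrite -(addrK (\sum_(k < n.+1) (if (m + k == l)%N then q m *: z k else 0))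
  (conv q z m n.+1 l)).
by apply: NB => //; apply: Nsum => i; case: ifP => // _; exact: Naz.
Qed.

End Gauss.

Lemma torsion_free_scalerI (A : idomainType) (M : lmodType A) (a : A) :
  torsion_free M -> a != 0 -> injective ( *:%R a : M -> M).
Proof.
move=> tf a0 x y /eqP; rewrite -subr_eq0 -scalerBr => /eqP/tf[/eqP|/eqP].
  by rewrite (negbTE a0).
by rewrite subr_eq0 => /eqP.
Qed.

(** * Common divisors under the PS property *)

Section Divisibility.

Variable A : idomainType.

Definition divides (a b : A) : Prop := exists c, b = c * a.

Lemma divides0 a : divides a 0.
Proof. by exists 0; rewrite mul0r. Qed.

Lemma divides_refl a : divides a a.
Proof. by exists 1; rewrite mul1r. Qed.

Lemma divides_trans a b c : divides a b -> divides b c -> divides a c.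
Proof. by move=> [u ->] [v ->]; exists (v * u); rewrite mulrA. Qed.

Definition common_divisor (P : seq A) (a : A) : Prop :=
  a != 0 /\ forall p, p \in P -> divides a p.

Lemma common_divisor_cons p P a :
  common_divisor P a -> divides a p -> common_divisor (p :: P) a.
Proof.
by move=> [a0 aP] ap; split=> // r; rewrite inE => /orP[/eqP->|/aP].
Qed.

Lemma common_divisor_behead p P a :
  common_divisor (p :: P) a -> common_divisor P a.
Proof. by move=> [a0 aP]; split=> // r rP; apply: aP; rewrite inE rP orbT. Qed.

Lemma common_divisor_trans P a b :
  divides a b -> common_divisor P b -> common_divisor P a.
Proof.
move=> ab [b0 bP]; split=> [|r rP]; last exact: (divides_trans ab (bP _ rP)).
by case: ab b0 => c ->; rewrite mulf_eq0 negb_or => /andP[].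
Qed.

(** Induction on [P]. If a w = r y for a common divisor [a] of the tail and p w = r x for the head,
    then a x = p y. In a refinement a = c f, p = c d, x = d z, y = f z, the element [c] divides both
    [a] and [p], and cancelling [d] in p w = r x gives c w = r z. *)
Lemma PS_module_common_divisor (M : lmodType A) (P : seq A) (r : A) (w : M) :
  PS_module M -> has (predC1 0) P -> r != 0 ->
  (forall p, p \in P -> exists x, p *: w = r *: x) ->
  exists2 a, common_divisor P a & exists x, a *: w = r *: x.
Proof.
move=> [tf PS] hP r0.
have [-> _|w0] := eqVneq w 0.
  exists 1; last by exists 0; rewrite !scaler0.
  by split=> [|p _]; [exact: oner_neq0 | exists p; rewrite mulr1].
have regl (a : A) (x : M) : a != 0 -> x != 0 -> a *: x != 0.
  by move=> a0 x0; apply/eqP => /tf[] /eqP; apply/negP.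
have canl (a : A) (x y : M) : a != 0 -> a *: x = a *: y -> x = y.
  by move=> a0; exact: torsion_free_scalerI.
elim: P hP => [//|p P IH] hP rP.
have [x ex] := rP p (mem_head _ _).
have rP' q : q \in P -> exists x, q *: w = r *: x.
  by move=> qP; apply: rP; rewrite inE qP orbT.
have [hP'|nP] := boolP (has (predC1 0) P); last first.
  have p0 : p != 0 by move: hP; rewrite /= (negbTE nP) orbF.
  exists p; last by exists x.
  split=> // q; rewrite inE => /orP[/eqP->|qP]; first exact: divides_refl.
  move/hasPn: nP => /(_ _ qP) /=; rewrite negbK => /eqP->; exact: divides0.
have [a cda [y ey]] := IH hP' rP'.
have [p0|p0] := eqVneq p 0.
  exists a; last by exists y.
  by apply: common_divisor_cons; rewrite ?p0 //; exact: divides0.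
have a0 : a != 0 by case: cda.
have x0 : x != 0.
  by apply: contraNneq (regl _ _ p0 w0) => x0; rewrite ex x0 scaler0.
have y0 : y != 0.
  by apply: contraNneq (regl _ _ a0 w0) => y0; rewrite ey y0 scaler0.
have e : a *: x = p *: y.
  by apply: (canl r) => //; rewrite !scalerA ![r * _]mulrC -!scalerA -ex -ey
    !scalerA mulrC.
have [c [d [f [z [ac pc xz yz]]]]] := PS _ _ _ _ a0 p0 x0 y0 e.
exists c.
  apply: common_divisor_cons; last by exists d; rewrite mulrC.
  by apply: common_divisor_trans cda; exists f; rewrite mulrC.
exists z; have d0 : d != 0 by apply: contraNneq p0 => d0; rewrite pc d0 mulr0.
by apply: (canl d) => //; rewrite !scalerA ![d * _]mulrC -pc ex xz scalerA.
Qed.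

Hypothesis PSA : PS_domain A.

(** The element found plays the role of an lcm of [a] and [b]. Let c = u a = v b divide the tail and
    let p = y a = x b be the head. Then u x = v y, and a refinement u = k f, v = k d, x = d z, y = f
    z gives f a = d b, which divides both c = k f a and p = z f a. *)
Lemma common_divisor_directed (P : seq A) a b :
  has (predC1 0) P -> common_divisor P a -> common_divisor P b ->
  exists2 c, common_divisor P c & divides a c /\ divides b c.
Proof.
elim: P => [//|p P IH] hP ca cb.
have ap : divides a p by case: ca => _; apply; rewrite mem_head.
have bp : divides b p by case: cb => _; apply; rewrite mem_head.
have a0 : a != 0 by case: ca. have b0 : b != 0 by case: cb.
have [hP'|nP] := boolP (has (predC1 0) P); last first.
  have p0 : p != 0 by move: hP; rewrite /= (negbTE nP) orbF.
  exists p => //; split=> // q; rewrite inE => /orP[/eqP->|qP].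
    exact: divides_refl.
  move/hasPn: nP => /(_ _ qP) /=; rewrite negbK => /eqP->; exact: divides0.
have [c cc [ac bc]] :=
  IH hP' (common_divisor_behead ca) (common_divisor_behead cb).
have [p0|p0] := eqVneq p 0.
  by exists c => //; apply: common_divisor_cons; rewrite ?p0 //; exact: divides0.
have c0 : c != 0 by case: cc.
case: ac => u eu; case: bc => v ev; case: bp => x ex; case: ap => y ey.
have nzl (s t r : A) : r = s * t -> r != 0 -> s != 0.
  by move=> -> /=; rewrite mulf_eq0 negb_or => /andP[].
have e : u * x = v * y.
  apply: (mulIf a0); apply: (mulIf b0).
  rewrite -!(mulrA (_ * _)) [in RHS](mulrC a) -[LHS]mulrACA -[RHS]mulrACA.
  by rewrite -eu -ev -ex -ey.
have [k [d [f [z [uk vk xz yz]]]]] :=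
  PSA.2 u v x y (nzl _ _ _ eu c0) (nzl _ _ _ ev c0) (nzl _ _ _ ex p0)
    (nzl _ _ _ ey p0) e.
have k0 : k != 0 by apply: (nzl k f u) => //; exact: nzl eu c0.
have fadb : f * a = d * b.
  by apply: (mulfI k0); rewrite !mulrA -uk -vk -eu -ev.
exists (f * a); last by split; [exists f | exists d; rewrite fadb].
apply: common_divisor_cons.
  by apply: common_divisor_trans cc; exists k; rewrite mulrA -uk.
by exists z; rewrite ey yz mulrA [z * f]mulrC.
Qed.

(** Each [G k] passes to multiples, so directedness merges finitely many witnesses into one. *)
Lemma common_divisor_all (P : seq A) (G : nat -> A -> Prop) n :
  has (predC1 0) P ->
  (forall k a b, divides a b -> G k a -> G k b) ->
  (forall k, exists2 a, common_divisor P a & G k a) ->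
  exists2 a, common_divisor P a & forall k, (k < n)%N -> G k a.
Proof.
move=> hP Gup ex; elim: n => [|n [a ca Ga]].
  by have [a ca _] := ex 0; exists a.
have [b cb Gb] := ex n.
have [c cc [ac bc]] := common_divisor_directed hP ca cb.
exists c => // k; rewrite ltnS leq_eqVlt => /orP[/eqP->|/Ga Gka].
  exact: Gup bc Gb.
exact: Gup ac Gka.
Qed.

End Divisibility.

(** * Coefficients of elements of M[X] *)

Section PolyModule.

Variables (A : idomainType) (M : lmodType A).

Local Notation polytens := (tens (@polyC A)).

Lemma mcoef_exists (i : nat) :
  exists h : {additive poly_module M -> M},
    forall x (p : {poly A}), h (polytens x p) = p`_i *: x.
Proof.
apply: (@tensor_lift _ _ _ M M (fun x (p : {poly A}) => p`_i *: x)).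
- by move=> x y p; rewrite scalerDr.
- by move=> x p q; rewrite coefD scalerDl.
- by move=> a x p; rewrite coefCM scalerA mulrC.
Qed.

Definition mcoef (i : nat) : {additive poly_module M -> M} :=
  projT1 (cid (mcoef_exists i)).

Lemma mcoef_tens i x (p : {poly A}) : mcoef i (polytens x p) = p`_i *: x.
Proof. by rewrite /mcoef; case: cid => h /= ->. Qed.

Definition poly_module_of (n : nat) (m : nat -> M) : poly_module M :=
  \sum_(i < n) polytens (m i) 'X^i.

Lemma mcoef_poly_module_of n m i :
  mcoef i (poly_module_of n m) = if (i < n)%N then m i else 0.
Proof.
rewrite /poly_module_of raddf_sum /=.
under eq_bigr do rewrite mcoef_tens coefXn.
case: ltnP => hi; last first.
  by rewrite big1 // => k _; rewrite gtn_eqF ?scale0r // (leq_trans (ltn_ord k)).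
rewrite (bigD1 (Ordinal hi)) //= eqxx scale1r big1 ?addr0 // => k.
by rewrite eq_sym -val_eqE /= => /negbTE->; rewrite scale0r.
Qed.

Lemma tens0l (p : {poly A}) : polytens (0 : M) p = 0.
Proof. by apply: (addrI (polytens 0 p)); rewrite -tensDl !addr0. Qed.

Lemma tens0r (x : M) : polytens x 0 = 0.
Proof. by apply: (addrI (polytens x 0)); rewrite -tensDr !addr0. Qed.

(** The expansion is asserted for every large [N], so that two elements can be written with the same
    number of terms. *)
Lemma poly_module_of_mcoef (t : poly_module M) :
  exists n, forall N, (n <= N)%N -> t = poly_module_of N (mcoef^~ t).
Proof.
elim/tensor_ind: t => [|s t [n hs] [m ht]|x p].
- exists 0%N => N _; rewrite /poly_module_of big1 // => i _.
  by rewrite raddf0 tens0l.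
- exists (maxn n m) => N; rewrite geq_max => /andP[/hs es /ht et].
  rewrite {1}es {1}et /poly_module_of -big_split; apply: eq_bigr => i _ /=.
  by rewrite raddfD tensDl.
- exists (size p) => N hN; rewrite /poly_module_of.
  under eq_bigr do rewrite mcoef_tens tensZ mul_polyC.
  have -> : p = \sum_(i < N) p`_i *: 'X^i.
    rewrite -poly_def; apply/polyP => i; rewrite coef_poly.
    by case: ltnP => // /(leq_trans hN) h; rewrite nth_default.
  have poly_coef (i : 'I_N) : (\sum_(k < N) p`_k *: 'X^k)`_i = p`_i.
    by rewrite -poly_def coef_poly ltn_ord.
  under [RHS]eq_bigr do rewrite poly_coef.
  elim/big_ind2: _ => [|p1 t1 p2 t2 <- <-|//]; first exact: tens0r.
  exact: tensDr.
Qed.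

Lemma mcoef_inj (s t : poly_module M) :
  (forall i, mcoef i s = mcoef i t) -> s = t.
Proof.
move=> e; have [n hs] := poly_module_of_mcoef s.
have [m ht] := poly_module_of_mcoef t.
rewrite {1}(hs _ (leq_maxl n m)) [RHS](ht _ (leq_maxr n m)).
by apply: eq_bigr => i _; rewrite e.
Qed.

Lemma mcoef_bounded (t : poly_module M) :
  exists n, forall i, (n <= i)%N -> mcoef i t = 0.
Proof.
have [n ht] := poly_module_of_mcoef t; exists n => i hi.
by rewrite (ht n) // mcoef_poly_module_of ltnNge hi.
Qed.

Lemma mcoef_scale (p : {poly A}) (t : poly_module M) n l :
  (forall i, (n <= i)%N -> mcoef i t = 0) ->
  mcoef l (p *: t) = conv (fun i => p`_i) (mcoef^~ t) (size p) n l.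
Proof.
move=> ht; have et : t = poly_module_of n (mcoef^~ t).
  apply: mcoef_inj => i; rewrite mcoef_poly_module_of; case: ltnP => // /ht //.
rewrite {1}et -{1}[p]coefK poly_def /poly_module_of scaler_suml raddf_sum /=.
apply: eq_bigr => i _; rewrite scaler_sumr raddf_sum; apply: eq_bigr => k _ /=.
rewrite scale_tens mcoef_tens -scalerAl -exprD coefZ coefXn eq_sym.
by case: ifP => _; rewrite ?mulr1 // mulr0 scale0r.
Qed.

Lemma mcoef_scaleC (a : A) (t : poly_module M) l :
  mcoef l (a%:P *: t) = a *: mcoef l t.
Proof.
elim/tensor_ind: t => [|s t hs ht|x q].
- have e0 : mcoef l 0 = 0 by exact: raddf0.
  by rewrite (scaler0 (poly_module M)) !e0 scaler0.
- have eD (u v : poly_module M) : mcoef l (u + v) = mcoef l u + mcoef l v.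
    exact: raddfD.
  by rewrite (scalerDr a%:P (s : poly_module M)) !eD hs ht scalerDr.
- by rewrite scale_tens !mcoef_tens coefCM scalerA.
Qed.

(** If the coefficients of [t] vanish from n + 1 on, the coefficient of p t in degree deg p + n is
    the leading coefficient of [p] times t_n. Hence t_n = 0, and the bound descends to 0. *)
Lemma poly_module_torsion_free :
  torsion_free M -> torsion_free (poly_module M).
Proof.
move=> tf p t pt0; have [->|p0] := eqVneq p 0; [by left | right].
have [n] := mcoef_bounded t; elim: n => [|n IH] hn.
  by apply: mcoef_inj => i; rewrite hn // raddf0.
apply: IH => i; rewrite leq_eqVlt => /orP[/eqP<-|/hn//].
have := mcoef_scale p ((size p).-1 + n) hn.
rewrite pt0 raddf0 -{1}(@prednK (size p)) ?size_poly_gt0 // conv_top.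
by move/esym/tf => [/eqP|//]; rewrite -lead_coefE lead_coef_eq0 (negbTE p0).
Qed.

Lemma mcoef_divisible (r a : A) (t : poly_module M) :
  (forall i, exists x, a *: mcoef i t = r *: x) ->
  exists z, a%:P *: t = r%:P *: z.
Proof.
move=> /choice[m hm]; have [n hn] := mcoef_bounded t.
(* Choice yields an infinite sequence [m]; it is cut where the coefficients of [t] vanish. *)
exists (poly_module_of n m); apply: mcoef_inj => i.
rewrite !mcoef_scaleC mcoef_poly_module_of; case: ltnP => hi; first exact: hm.
by rewrite hn // !scaler0.
Qed.

End PolyModule.

(** * The embedding of M in the tensor product with K *)

Section FractionTensor.

Variables (A : idomainType) (M : lmodType A).

Local Notation K := {fraction A}.
Local Notation "x %:F" := (@FracField.tofrac A x).
Local Notation fractens := (tens (@FracField.tofrac A)).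

Lemma tofrac_inj : injective (@FracField.tofrac A).
Proof. by move=> a b /eqP; rewrite tofrac_eq => /eqP. Qed.

Lemma fraction_denominator (u : K) :
  exists2 s, s != 0 & exists a, s%:F * u = a%:F.
Proof.
elim/quotW: u => r; exists (r.2); first exact: denom_ratioP.
exists r.1; unlock FracField.tofrac.
rewrite -[LHS]FracField.pi_mul.
apply/eqmodP; rewrite /= FracField.equivfE /FracField.mulf.
rewrite !numden_Ratio ?mulf_neq0 ?oner_neq0 ?denom_ratioP //.
by rewrite mul1r mulr1.
Qed.

(* Junk value 0 when s * u is not in A. *)
Definition clear (s : A) (u : K) : A :=
  if pselect (exists a, s%:F * u = a%:F) is left e then projT1 (cid e) else 0.

Lemma clearP s u a : s%:F * u = a%:F -> clear s u = a.
Proof.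
move=> e; rewrite /clear; case: pselect => [h|[]]; last by exists a.
by case: cid => b /= eb; apply: tofrac_inj; rewrite -eb.
Qed.

Lemma clearE (s : A) (u : K) a c : s%:F * u = a%:F -> clear (c * s) u = c * a.
Proof. by move=> e; apply: clearP; rewrite !rmorphM /= -mulrA e. Qed.

(* Multiplication by s followed by K (x) M -> M, on representatives; it is not
   well defined on classes, but a relation is killed by all multiples of some
   s != 0, which is enough to embed M in K (x) M. *)
Definition clear_tensor (s : A) (t : {freeg (M * K)%type}) : M :=
  fglift (fun p : M * K => clear s p.2 *: p.1 : zmodule M) t.

Lemma clear_tensorB s : zmod_morphism (clear_tensor s).
Proof. exact: (@lift_is_additive _ _ (zmodule M)). Qed.

Lemma clear_tensorU s x b : clear_tensor s << (x, b) >> = clear s b *: x.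
Proof. by rewrite /clear_tensor liftU scale1r. Qed.

(** Asking for all multiples of [s] lets the witnesses of two relations be multiplied together. For
    additivity in the second factor and for scalars, [s] clears every fraction that occurs, so that
    [clear] takes no junk value; additivity in the first factor needs no clearing. *)
Lemma clear_tensor_rel (t : {freeg (M * K)%type}) :
  tensor_rel (@FracField.tofrac A) t ->
  exists2 s, s != 0 & forall c, clear_tensor (c * s) t = 0.
Proof.
have ct0 s : clear_tensor s 0 = 0 by rewrite -(subrr 0) clear_tensorB subrr.
elim=> [|u v _ [s s0 hs] _ [s' s'0 hs']|x y b|x b b'|a x b].
- by exists 1; [exact: oner_neq0 | move=> c; exact: ct0].
- exists (s * s'); first by rewrite mulf_neq0.
  by move=> c; rewrite clear_tensorB {1}mulrC -mulrA mulrC hs mulrA hs' subrr.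
- exists 1; [exact: oner_neq0 | move=> c].
  by rewrite !clear_tensorB !clear_tensorU /= scalerDr addrAC addrK subrr.
- have [s s0 [a ea]] := fraction_denominator b.
  have [s' s'0 [a' ea']] := fraction_denominator b'.
  exists (s * s'); first by rewrite mulf_neq0.
  move=> c; rewrite !clear_tensorB !clear_tensorU /=.
  have eb : (s * s')%:F * b = (s' * a)%:F.
    by rewrite !rmorphM /= mulrAC ea mulrC.
  have eb' : (s * s')%:F * b' = (s * a')%:F.
    by rewrite !rmorphM /= -mulrA ea'.
  have ebb' : (s * s')%:F * (b + b') = (s' * a + s * a')%:F.
    by rewrite mulrDr eb eb' rmorphD.
  rewrite (clearE c eb) (clearE c eb') (clearE c ebb').
  by rewrite mulrDr scalerDl addrAC addrK subrr.
- have [s s0 [d ed]] := fraction_denominator b.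
  exists s => // c; rewrite clear_tensorB !clear_tensorU /= (clearE c ed).
  have ead : s%:F * (a%:F * b) = (a * d)%:F by rewrite mulrCA ed rmorphM.
  by rewrite (clearE c ead) scalerA -mulrA (mulrC d) subrr.
Qed.

(** Some s != 0 kills the difference of the two representatives; as it clears 1 to [s], this reads s
    x = s y. *)
Lemma to_frac_tensor_inj : torsion_free M -> injective (@to_frac_tensor A M).
Proof.
move=> tf x y /tensor_piP/clear_tensor_rel[s s0 /(_ 1)].
rewrite mul1r clear_tensorB !clear_tensorU (@clearP _ _ s) ?mulr1 //.
by move/eqP; rewrite subr_eq0 => /eqP; exact: torsion_free_scalerI.
Qed.

End FractionTensor.

(** * Integrality over A from finitely generated spans *)

Section IntegralSpan.

Variable A : idomainType.

Local Notation K := {fraction A}.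
Local Notation "x %:F" := (@FracField.tofrac A x).

(** Determinant trick: the [g i] form a nonzero row eigenvector, with eigenvalue [u], of a matrix
    over A, whose characteristic polynomial is the required monic polynomial. *)
Lemma integral_of_finite_span (I : finType) (g : I -> K) (a : I -> I -> A) u :
  (exists i, g i != 0) -> (forall i, u * g i = \sum_j (a i j)%:F * g j) ->
  integralOver (@FracField.tofrac A) u.
Proof.
move=> [i0 gi0] ug.
pose B : 'M[A]_#|I| := \matrix_(j, i) a (enum_val i) (enum_val j).
pose v : 'rV[K]_#|I| := \row_i g (enum_val i).
exists (char_poly B); first exact: char_poly_monic.
rewrite map_char_poly -eigenvalue_root_char; apply/eigenvalueP; exists v.
  apply/rowP => i; rewrite !mxE ug (reindex (@enum_val I predT)) /=; last first.
    by apply: onW_bij; exact: enum_val_bij.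
  by apply: eq_bigr => j _; rewrite !mxE mulrC.
apply: contraNneq gi0 => v0.
have := congr1 (fun w : 'rV__ => w 0 (enum_rank i0)) v0.
by rewrite !mxE enum_rankK => ->.
Qed.

Variable U : seq K.

(** The filtration of A[U] by degree. Degrees are recorded because finite generation will come from
    bounding them. *)
Inductive wspan (d : nat) : K -> Prop :=
| Wspan0 : wspan d 0
| WspanD x y : wspan d x -> wspan d y -> wspan d (x + y)
| WspanW a s : all [in U] s -> (size s <= d)%N ->
    wspan d (a%:F * \prod_(x <- s) x).

Lemma wspanC d a : wspan d a%:F.
Proof. by have := @WspanW d a [::] isT isT; rewrite big_nil mulr1. Qed.

Lemma wspan_mem d u : u \in U -> wspan d.+1 u.
Proof.
move=> uU; have := @WspanW d.+1 1 [:: u]; rewrite /= uU big_seq1 tofrac1 mul1r.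
exact.
Qed.

Lemma wspanM d e x y : wspan d x -> wspan e y -> wspan (d + e) (x * y).
Proof.
move=> wx wy; elim: wx => [|x1 x2 _ h1 _ h2|a s sU sd].
- by rewrite mul0r; exact: Wspan0.
- by rewrite mulrDl; exact: WspanD.
elim: wy => [|y1 y2 _ h1 _ h2|b t tU td].
- by rewrite mulr0; exact: Wspan0.
- by rewrite mulrDr; exact: WspanD.
rewrite mulrACA -rmorphM -big_cat; apply: WspanW; first by rewrite all_cat sU.
by rewrite size_cat leq_add.
Qed.

Lemma wspanN d x : wspan d x -> wspan d (- x).
Proof.
move=> wx; rewrite -mulN1r -[d]add0n; apply: wspanM => //.
by rewrite -tofrac1 -tofracN; exact: wspanC.
Qed.

Lemma wspanX u n : u \in U -> wspan n (u ^+ n).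
Proof.
move=> uU; elim: n => [|n IH]; first by rewrite expr0 -tofrac1; exact: wspanC.
by rewrite exprS -[n.+1]add1n; apply: wspanM => //; exact: wspan_mem.
Qed.

Lemma wspan_power u n m :
  u \in U -> (n <= m)%N -> wspan n (u ^+ n.+1) -> wspan m (u ^+ m.+1).
Proof.
move=> uU nm; move: (m - n)%N (subnKC nm) => k <- h.
by rewrite -addSn exprD; apply: wspanM => //; exact: wspanX.
Qed.

Lemma wspan_power_uniform :
  (forall u, u \in U -> exists n, wspan n (u ^+ n.+1)) ->
  exists n, forall u, u \in U -> wspan n (u ^+ n.+1).
Proof.
move=> h; suff /(_ (size U))[n hn] k : exists n, forall u, u \in U ->
    (index u U < k)%N -> wspan n (u ^+ n.+1).
  by exists n => u uU; apply: hn => //; rewrite index_mem.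
elim: k => [|k [n hn]]; first by exists 0%N.
have [kU|Uk] := ltnP k (size U); last first.
  exists n => u uU; rewrite ltnS leq_eqVlt => /orP[/eqP e|]; last exact: hn.
  by move: uU; rewrite -index_mem e ltnNge Uk.
have [m hm] := h _ (mem_nth 0 kU); exists (maxn n m) => u uU.
rewrite ltnS leq_eqVlt => /orP[/eqP e|/(hn u uU)].
  by apply: (wspan_power uU (leq_maxr n m)); rewrite -[u](nth_index 0 uU) e.
exact: wspan_power (leq_maxl n m).
Qed.

Lemma pigeonhole_count (T : eqType) (r s : seq T) n :
  all [in r] s -> (n * size r < size s)%N ->
  exists2 x, x \in r & (n < count_mem x s)%N.
Proof.
elim: r s => [|x r IH] s /allP sr.
  by case: s sr => // y s /(_ y (mem_head _ _)).
have [nx|xn] := ltnP n (count_mem x s); first by exists x; rewrite ?mem_head.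
move=> hs; have [||y yr ny] := IH [seq y <- s | y != x].
- by apply/allP => y; rewrite mem_filter => /andP[/negbTE yx /sr]; rewrite inE yx.
- rewrite size_filter -(ltn_add2l (count_mem x s)) count_predC.
  by apply: leq_ltn_trans hs; rewrite /= mulnS leq_add2r.
exists y; first by rewrite inE yr orbT.
by apply: leq_trans ny _; rewrite count_filter; apply: sub_count => z /andP[].
Qed.

(** By the pigeonhole principle, a monomial of degree n |U| + 1 contains some u^(n+1); rewriting
    this power in degree at most n lowers the total degree. *)
Lemma wspan_stable n :
  (forall u, u \in U -> wspan n (u ^+ n.+1)) ->
  forall x, wspan (n * size U).+1 x -> wspan (n * size U) x.
Proof.
move=> h x; elim=> [|y z _ hy _ hz|a s sU]; [exact: Wspan0|exact: WspanD|].
rewrite leq_eqVlt => /orP[/eqP es|]; last by move=> ?; exact: WspanW.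
have [|u uU nu] := pigeonhole_count sU (n := n); first by rewrite es.
set r := [seq x <- s | predC (pred1 u) x].
have rU : all [in U] r.
  by apply/allP => y; rewrite mem_filter => /andP[_]; exact: (allP sU).
have size_s : (count_mem u s + size r)%N = (n * size U).+1.
  by rewrite -es -(count_predC (pred1 u) s) size_filter.
have -> : \prod_(i <- s) i = u ^+ count_mem u s * \prod_(i <- r) i.
  rewrite -(perm_big _ (permEl (perm_filterC (pred1 u) s))) big_cat.
  have /all_pred1P -> := filter_all (pred1 u) s.
  by rewrite size_filter big_nseq iter_mulr_1.
(* Here [k] is the multiplicity of [u] beyond n + 1, and the degrees that remain are n for the
   rewritten power, [k] for the excess and [size r] for the other factors. *)
move: size_s; rewrite -(subnKC nu); move: (_ - _)%N => k.
rewrite !addSn => -[<-]; rewrite -addSn exprD -mulrA mulrCA -addnA.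
apply: wspanM; first exact: h.
rewrite mulrCA; apply: wspanM; [exact: wspanX | exact: WspanW].
Qed.

(** A finite index type is needed for the determinant trick. The extra letter [ord_max] falls
    outside [U], where [nth] returns 1, and so pads monomials of degree below [d] to exactly [d]
    factors. *)
Lemma wspan_family d x :
  wspan d x -> exists c : d.-tuple 'I_(size U).+1 -> A,
    x = \sum_t (c t)%:F * \prod_(i <- t) nth 1 U i.
Proof.
elim=> [|y z _ [c ->] _ [c' ->]|a s sU sd].
- by exists (fun=> 0); rewrite big1 // => t _; rewrite tofrac0 mul0r.
- exists (fun t => c t + c' t); rewrite -big_split; apply: eq_bigr => t _ /=.
  by rewrite tofracD mulrDl.
pose t0 : seq 'I_(size U).+1 :=
  [seq inord (index x U) | x <- s] ++ nseq (d - size s) ord_max.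
have st0 : size t0 == d by rewrite size_cat size_map size_nseq subnKC.
exists (fun t => if t == Tuple st0 then a else 0).
rewrite (bigD1 (Tuple st0)) //= eqxx [X in _ + X]big1 ?addr0; last first.
  by move=> t /negbTE->; rewrite tofrac0 mul0r.
congr (_ * _); rewrite big_cat /= big_map [X in _ * X]big1_seq ?mulr1.
  rewrite !big_seq; apply: eq_bigr => y /(allP sU) yU.
  by rewrite inordK ?nth_index // ltnS index_size.
by move=> i /andP[_]; rewrite mem_nseq => /andP[_ /eqP->]; rewrite nth_default.
Qed.

Lemma wspan_prod d (t : d.-tuple 'I_(size U).+1) :
  wspan d (\prod_(i <- t) nth 1 U i).
Proof.
case: t => t /= /eqP <-; elim: t => [|i t IH].
  by rewrite big_nil -tofrac1; exact: wspanC.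
rewrite big_cons /= -add1n; apply: wspanM => //.
have [iU|Ui] := ltnP i (size U); first by apply: wspan_mem; exact: mem_nth.
by rewrite nth_default // -tofrac1; exact: wspanC.
Qed.

(** For d = n |U| the span of degree [d] is finitely generated, and [wspan_stable] makes it stable
    under multiplication by each element of [U]. *)
Lemma wspan_integral :
  (forall u, u \in U -> exists n, wspan n (u ^+ n.+1)) ->
  forall u, u \in U -> integralOver (@FracField.tofrac A) u.
Proof.
move=> /wspan_power_uniform[n hn] u uU; set d := (n * size U)%N.
have stab (t : d.-tuple 'I_(size U).+1) :
    wspan d (u * \prod_(i <- t) nth 1 U i).
  apply: wspan_stable => //; rewrite -add1n; apply: wspanM.
    exact: wspan_mem.
  exact: wspan_prod.
have /choice[a ha] := fun t => wspan_family (stab t).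
apply: (integral_of_finite_span (a := a) _ ha).
(* The tuple of padding letters gives the generator 1, so the generators are not all zero. *)
exists [tuple of nseq d ord_max]; rewrite big1_seq ?oner_neq0 // => i.
by rewrite mem_nseq => /andP[_ /andP[_ /eqP->]]; rewrite nth_default.
Qed.

End IntegralSpan.

(** * Contents over an integrally closed domain *)

Section Content.

Variable A : idomainType.

Local Notation K := {fraction A}.
Local Notation "x %:F" := (@FracField.tofrac A x).

Lemma coefM_conv (p h : {poly A}) l :
  (p * h)`_l = conv (fun i => p`_i) (fun k => h`_k : A^o) (size p) (size h) l.
Proof.
rewrite -{1}[p]coefK -{1}[h]coefK !poly_def mulr_suml coef_sum.
apply: eq_bigr => i _; rewrite mulr_sumr coef_sum; apply: eq_bigr => k _.
rewrite -scalerAl -scalerAr -exprD !coefZ coefXn eq_sym.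
by case: ifP; rewrite ?mulr1 // !mulr0.
Qed.

(* With w = h_k / s and u_j = p_j w, the polynomial p / p_j has a coefficient 1
   over A[p_i / p_j], so Gauss' lemma puts u_j in that ring; as p_i / p_j is
   u_i / u_j, some u_j ^ (n + 1) has degree at most n in the u_i. *)
Lemma integrally_closed_domain_content (p h f : {poly A}) s :
  integrally_closed_domain A -> s != 0 -> p * h = s%:P * f ->
  forall j k, divides s (p`_j * h`_k).
Proof.
move=> icA s0 phf j k.
have sF0 : s%:F != 0 by rewrite tofrac_eq0.
have [hk0|hk0] := eqVneq h`_k 0; first by rewrite hk0 mulr0; exact: divides0.
have [pj|pj] := ltnP j (size p); last first.
  by rewrite [p`_j]nth_default // mul0r; exact: divides0.
set w := (h`_k)%:F / s%:F.
have w0 : w != 0 by rewrite mulf_neq0 ?invr_eq0 ?tofrac_eq0.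
pose U := [seq c%:F * w | c <- p].
suff /icA[a ea] : integralOver (@FracField.tofrac A) ((p`_j)%:F * w).
  exists a; apply: tofrac_inj; rewrite !tofracM -ea -mulrA /w.
  by rewrite mulfVK.
apply: (@wspan_integral _ U); last by apply: map_f; exact: mem_nth.
move=> _ /mapP[c cp ->]; set u := c%:F * w.
have uU : u \in U by exact: map_f.
have [c0|c0] := eqVneq c 0.
  by exists 0%N; rewrite /u c0 tofrac0 mul0r expr1; exact: Wspan0.
have cF0 : c%:F != 0 by rewrite tofrac_eq0.
have u0 : u != 0 by rewrite mulf_neq0.
(* [V] collects the quotients by u^n of elements of degree at most n. It is a ring containing A and
   the p_i / c = (p_i w) / u, and [V u] says exactly that some u^(n+1) has degree at most n. *)
pose V x := exists n, wspan U n (u ^+ n * x).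
have V0 : V 0 by exists 0%N; rewrite mulr0; exact: Wspan0.
have VB x y : V x -> V y -> V (x - y).
  move=> [n wx] [m wy]; exists (n + m)%N; rewrite mulrBr exprD; apply: WspanD.
    by rewrite mulrAC; apply: wspanM => //; exact: wspanX.
  by rewrite -mulrA; apply: wspanN; apply: wspanM => //; exact: wspanX.
have VM x y : V x -> V y -> V (x * y).
  move=> [n wx] [m wy]; exists (n + m)%N.
  by rewrite exprD mulrACA; exact: wspanM.
pose q i := (p`_i)%:F / c%:F.
(* The factor [c] makes up for the division in [q], so that [q] and [z] multiply to p h / s = f;
   moreover [z k] is [u]. *)
pose z i : K^o := c%:F * ((h`_i)%:F / s%:F).
have Vq i : V (q i).
  have [ip|pi] := ltnP i (size p); last first.
    by rewrite /q nth_default // tofrac0 mul0r.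
  exists 1%N; rewrite expr1 /q /u mulrC mulrA mulfVK //.
  by apply: wspan_mem; apply: map_f; exact: mem_nth.
have convE l : conv q z (size p) (size h) l = (f`_l)%:F.
  apply: (mulIf sF0); rewrite -tofracM [f`_l * s]mulrC -coefCM -phf.
  rewrite coefM_conv /conv mulr_suml rmorph_sum; apply: eq_bigr => i _ /=.
  rewrite mulr_suml rmorph_sum; apply: eq_bigr => i' _ /=.
  case: ifP => _; last by rewrite mul0r tofrac0.
  have cancel (a b : K) : a / c%:F * (c%:F * (b / s%:F)) * s%:F = a * b.
    by rewrite mulrA (mulfVK cF0) -mulrA (mulfVK sF0).
  by rewrite [RHS]tofracM; exact: cancel.
have kh : (k < size h)%N.
  by rewrite ltnNge; apply: contraNN hk0 => ?; rewrite nth_default.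
rewrite -index_mem in cp.
have qc : q (index c p) = 1 by rewrite /q nth_index ?divff // -index_mem.
have [n wn] : V u.
  apply: (@gauss_unit_coef K K^o V V V0 VB VM q _ _ _ z Vq qc cp _ k kh).
  by move=> l; rewrite convE; exists 0%N; rewrite mul1r; exact: wspanC.
by exists n; rewrite exprSr.
Qed.

End Content.

(** * Contents over an integrally closed module *)

Section ModuleContent.

Variables (A : idomainType) (M : lmodType A).

Local Notation K := {fraction A}.
Local Notation "x %:F" := (@FracField.tofrac A x).
Local Notation fractens := (tens (@FracField.tofrac A)).

(** The entry p_j has least valuation; dividing by it puts all entries in [V] and makes one of them
    1. The induction compares p_n with the minimum of the earlier entries. *)
Lemma valuation_overring_min (V : K -> Prop) (p : nat -> K) n :
  valuation_overring V -> (exists2 i, (i < n)%N & p i != 0) ->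
  exists2 j, (j < n)%N & p j != 0 /\ forall i, (i < n)%N -> V (p i / p j).
Proof.
move=> hV; have V0 : V 0 by rewrite -tofrac0; exact: overring_base hV _.
have V1 : V 1 by rewrite -tofrac1; exact: overring_base hV _.
elim: n => [[]//|n IH [i]].
have [pn0|pn0] := eqVneq (p n) 0.
  rewrite ltnS leq_eqVlt => /orP[/eqP->|lin pi0]; first by rewrite pn0 eqxx.
  have [j jn [pj0 Vj]] := IH (ex_intro2 _ _ i lin pi0).
  exists j; first exact: ltnW.
  split=> // i'; rewrite ltnS leq_eqVlt => /orP[/eqP->|/Vj//].
  by rewrite pn0 mul0r.
move=> _ _ {i}.
have [ex|nex] := pselect (exists2 i, (i < n)%N & p i != 0); last first.
  exists n => //; split=> // i; rewrite ltnS leq_eqVlt => /orP[/eqP->|lin].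
    by rewrite divff.
  have [->|pi0] := eqVneq (p i) 0; first by rewrite mul0r.
  by case: nex; exists i.
have [j jn [pj0 Vj]] := IH ex.
have [] := overring_valuation hV (u := p n / p j).
    by rewrite mulf_neq0 ?invr_eq0.
  move=> Vn; exists j; first exact: ltnW.
  by split=> // i; rewrite ltnS leq_eqVlt => /orP[/eqP->|/Vj//].
rewrite invf_div => Vn; exists n => //; split=> // i.
rewrite ltnS leq_eqVlt => /orP[/eqP->|/Vj Vi]; first by rewrite divff.
by have := overringM hV Vi Vn; rewrite mulrA mulfVK.
Qed.

Lemma overring_spanB (V : K -> Prop) (s t : frac_tensor M) :
  valuation_overring V -> overring_span V s -> overring_span V t ->
  overring_span V (s - t).
Proof.
move=> hV hs ht; apply: OverringSpanD => //; rewrite -scaleN1r.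
apply: OverringSpanZ => //; rewrite -tofrac1 -tofracN.
exact: overring_base hV _.
Qed.

(** As M is integrally closed, it suffices that p_j w_k / r lies in VM for every V. Dividing [p] by
    a coefficient of least valuation gives a polynomial over V with a coefficient 1, and Gauss'
    lemma applies with [N] taken to be VM, because p w / r = t has its coefficients in M. *)
Lemma integrally_closed_module_content (p : {poly A}) (w t : poly_module M) r :
  integrally_closed_module M -> r != 0 -> p *: w = r%:P *: t ->
  forall j k, exists x, p`_j *: mcoef M k w = r *: x.
Proof.
move=> [tf icM] r0 pwt j k.
have rF0 : r%:F != 0 by rewrite tofrac_eq0.
have [n hn] := mcoef_bounded w.
have [pj|pj] := ltnP j (size p); last first.
  by exists 0; rewrite nth_default // scale0r scaler0.
have [kn|nk] := ltnP k n; last first.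
  by exists 0; rewrite hn // !scaler0.
have [x ex] :
    exists x, fractens (p`_j *: mcoef M k w) r%:F^-1 = to_frac_tensor x.
  apply/icM => V hV.
  have [|i0 i0p [pi0 Vq]] := valuation_overring_min (p := fun i => (p`_i)%:F)
    (n := size p) hV.
    exists (size p).-1; first by rewrite prednK // (leq_ltn_trans _ pj).
    rewrite tofrac_eq0 -lead_coefE lead_coef_eq0 -size_poly_gt0.
    exact: leq_ltn_trans pj.
  pose q i := (p`_i)%:F / (p`_i0)%:F.
  (* The coefficient removed from [p] is moved to [w], which is also divided by [r]; thus q_i z_k =
     p_i w_k / r. *)
  pose z i : frac_tensor M := fractens (mcoef M i w) ((p`_i0)%:F / r%:F).
  have Vqi i : V (q i).
    have [/Vq//|pi] := ltnP i (size p).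
    rewrite /q nth_default // tofrac0 mul0r -tofrac0; exact: overring_base hV _.
  have qz i k' : q i *: z k' = fractens (p`_i *: mcoef M k' w) r%:F^-1.
    by rewrite /z scale_tens tensZ mulrA mulfVK.
  have Vz : overring_span V (z k).
    apply: (@gauss_unit_coef K _ V (overring_span V) _ _ _ q i0 (size p) n) => //.
    - exact: OverringSpan0.
    - by move=> *; exact: overring_spanB.
    - by move=> *; exact: OverringSpanZ.
    - by rewrite /q divff.
    move=> l; have -> : conv q z (size p) n l = to_frac_tensor (mcoef M l t).
      have := mcoef_scale p l hn; rewrite pwt mcoef_scaleC => el.
      have -> : to_frac_tensor (mcoef M l t) =
          fractens (r *: mcoef M l t) r%:F^-1.
        by rewrite tensZ divff.
      rewrite el /conv.
      have tensl_sum m (F : 'I_m -> M) (b : K) :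
          fractens (\sum_i F i) b = \sum_i fractens (F i) b.
        apply: (big_morph (fun x => fractens x b)) => [x y|].
          exact: tensDl.
        by apply: (addrI (fractens 0 b)); rewrite -tensDl !addr0.
      rewrite tensl_sum; apply: eq_bigr => i _.
      rewrite tensl_sum; apply: eq_bigr => k' _.
      case: ifP => _; first exact: qz.
      (* Additivity over the empty sum says that the tensor with first factor 0 vanishes. *)
      have := tensl_sum 0%N (fun=> 0) r%:F^-1; rewrite !big_ord0 => -> //.
    exact: OverringSpanM.
  by rewrite -qz; apply: OverringSpanZ.
exists x; apply: (to_frac_tensor_inj tf).
have -> : to_frac_tensor (r *: x) = r%:F *: to_frac_tensor x.
  by rewrite /to_frac_tensor tensZ scale_tens.
by rewrite -ex scale_tens divff.
Qed.

End ModuleContent.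

(** * Gcd with cleared denominators, and the refinement *)

Lemma divides_polyC (A : idomainType) (a : A) (p : {poly A}) :
  (forall c, c \in (p : seq A) -> divides a c) -> exists e, p = a%:P * e.
Proof.
move=> h; have /choice[c hc] : forall i, exists b, p`_i = b * a.
  move=> i; have [ip|pi] := ltnP i (size p); first by apply: h; exact: mem_nth.
  by exists 0; rewrite nth_default // mul0r.
exists (\poly_(i < size p) c i); apply/polyP => i; rewrite coefCM coef_poly.
case: ltnP => ip; first by rewrite hc mulrC.
by rewrite nth_default // mulr0.
Qed.

(** Pseudo-division by the gcd gives s1 f = f1 h and s2 g = g1 h, and s = s1 s2 serves both. The
    Bezout relation has the form c1 (u f + v g) = c2 h; multiplying it by [s] and cancelling [h]
    leaves the constant r = c2 s. *)
Lemma pseudo_gcd (A : idomainType) (f g : {poly A}) :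
  f != 0 -> exists (s r : A) (h f' g' u v : {poly A}),
  [/\ s != 0, r != 0, h != 0 & [/\ s%:P * f = f' * h, s%:P * g = g' * h
    & u * f' + v * g' = r%:P]].
Proof.
move=> f0; set h := gcdp f g.
have h0 : h != 0 by rewrite gcdp_eq0 negb_and f0.
have /Pdiv.Idomain.dvdpP[[s1 f1] /= s10 ef] := dvdp_gcdl f g.
have /Pdiv.Idomain.dvdpP[[s2 g1] /= s20 eg] := dvdp_gcdr f g.
have [[u v] /= /eqpP[[c1 c2] /= /andP[c10 c20] euv]] := Bezoutp f g.
rewrite -/h -!mul_polyC in ef eg euv.
have ef' : (s1 * s2)%:P * f = s2%:P * f1 * h.
  by rewrite polyCM mulrAC ef mulrC mulrA.
have eg' : (s1 * s2)%:P * g = s1%:P * g1 * h by rewrite polyCM -!mulrA eg.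
exists (s1 * s2), (c2 * (s1 * s2)), h, (s2%:P * f1), (s1%:P * g1),
  (c1%:P * u), (c1%:P * v).
split=> //; rewrite ?mulf_neq0 //; split=> //.
apply: (mulIf h0); rewrite mulrDl -!(mulrA (c1%:P * _)) -ef' -eg'.
by rewrite !(mulrCA _ (s1 * s2)%:P) -mulrDr -!mulrA -mulrDr euv mulrCA mulrA
  -polyCM.
Qed.

Theorem theorem5p4 (A : idomainType) (M : lmodType A)
    (hA : Schreier_domain A)
    (hMi : integrally_closed_module M) (hMps : PS_module M) :
  PS_module (poly_module M).
Proof.
have [icA PSA] := hA; have tfX := poly_module_torsion_free hMps.1.
split=> // f g x y f0 g0 x0 y0 fxgy.
have canl (p : {poly A}) (s t : poly_module M) :
    p != 0 -> p *: s = p *: t -> s = t.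
  by move=> p0; exact: torsion_free_scalerI.
have [s [r [h [f' [g' [u [v [s0 r0 h0 [ef eg euv]]]]]]]]] := pseudo_gcd g f0.
have rP0 : r%:P != 0 by rewrite polyC_eq0.
have sP0 : s%:P != 0 by rewrite polyC_eq0.
have fxgy' : f' *: x = g' *: y.
  apply: (canl h) => //.
  by rewrite !scalerA ![h * _]mulrC -ef -eg -!scalerA fxgy.
(* Over K, w / r is the common value of x / g' and y / f'. *)
pose w := u *: y + v *: x.
have ew_x : g' *: w = r%:P *: x.
  rewrite /w scalerDr !scalerA ![g' * _]mulrC -[(u * g') *: _]scalerA -fxgy'.
  by rewrite scalerA -scalerDl euv.
have ew_y : f' *: w = r%:P *: y.
  rewrite /w scalerDr !scalerA ![f' * _]mulrC -[(v * f') *: _]scalerA fxgy'.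
  by rewrite scalerA -scalerDl euv.
pose P : seq A := (f' : seq A) ++ (g' : seq A).
have hP : has (predC1 0) P.
  have f'0 : f' != 0.
    by apply: contraNneq (mulf_neq0 sP0 f0) => e; rewrite ef e mul0r.
  apply/hasP; exists (lead_coef f'); last by rewrite /= lead_coef_eq0.
  by rewrite mem_cat lead_coefE mem_nth // prednK // size_poly_gt0.
have [n hn] := mcoef_bounded w.
(* For each [k], the content lemma treats the coefficients of f' through [ew_y] and those of g'
   through [ew_x]; the PS property of M then gives one common divisor for this [k]. *)
have [a ca Ga] : exists2 a, common_divisor P a & forall k, (k < n)%N ->
    exists m, a *: mcoef M k w = r *: m.
  apply: common_divisor_all => // [k a b [c ->] [m em]|k].
    by exists (c *: m); rewrite -scalerA em !scalerA mulrC.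
  apply: PS_module_common_divisor => // p; rewrite mem_cat.
  case/orP=> /(nthP 0)[i _ <-].
    exact: integrally_closed_module_content ew_y _ _.
  exact: integrally_closed_module_content ew_x _ _.
have [b cb Gb] : exists2 b, common_divisor P b & forall k, (k < size h)%N ->
    divides s (b * h`_k).
  apply: common_divisor_all => // [k a' b [c ->] [m em]|k].
    by exists (c * m); rewrite -!mulrA -em.
  (* The same interpolation, in A as a module over itself, with h_k and [s] in place of w_k and
     [r]. *)
  have [|b cb [m em]] := PS_module_common_divisor PSA hP s0 (w := h`_k : A^o).
    move=> p; rewrite mem_cat => pP.
    have [m em] : divides s (p * h`_k).
      case/orP: pP => /(nthP 0)[i _ <-].
        exact: integrally_closed_domain_content (esym ef) _ _.
      exact: integrally_closed_domain_content (esym eg) _ _.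
    by exists m; rewrite -[LHS]/(p * h`_k) em mulrC.
  by exists b => //; exists m; rewrite [RHS]mulrC; exact: em.
(* A common multiple [l] of [a] and [b] inherits both divisibility properties and still divides all
   coefficients of f' and g'. *)
have [l [l0 lP] [al bl]] := common_divisor_directed PSA hP ca cb.
have lC0 : l%:P != 0 by rewrite polyC_eq0.
have [e ee] : exists e, f' = l%:P * e.
  by apply: divides_polyC => c cf; apply: lP; rewrite mem_cat cf.
have [d ed] : exists d, g' = l%:P * d.
  by apply: divides_polyC => c cg; apply: lP; rewrite mem_cat cg orbT.
have [c ec] : exists c, l%:P * h = s%:P * c.
  apply: divides_polyC => _ /(nthP 0)[i _ <-]; rewrite coefCM.
  have [/Gb[m em]|hi] := ltnP i (size h); last first.
    by rewrite [h`_i]nth_default // mulr0; exact: divides0.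
  by case: bl => k ->; exists (k * m); rewrite -!mulrA -em.
have [z ez] : exists z, l%:P *: w = r%:P *: z.
  apply: mcoef_divisible => i; have [/Ga[m em]|ni] := ltnP i n; last first.
    by exists 0; rewrite hn // !scaler0.
  by case: al => k ->; exists (k *: m); rewrite -scalerA em !scalerA mulrC.
(* From s p = p' h = l q h = s c q, cancel [s]; this serves both [f] and [g]. *)
have split_gcd (p p' q : {poly A}) :
    s%:P * p = p' * h -> p' = l%:P * q -> p = c * q.
  move=> ep ep'; apply: (mulfI sP0).
  by rewrite ep ep' mulrA -ec mulrAC.
exists c, d, e, z; split.
- exact: split_gcd ef ee.
- exact: split_gcd eg ed.
(* Here r x = g' w = d l w = r d z, and [r] cancels. *)
- apply: (canl r%:P) => //; rewrite -ew_x ed [l%:P * d]mulrC -scalerA ez.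
  by rewrite !scalerA mulrC.
- apply: (canl r%:P) => //; rewrite -ew_y ee [l%:P * e]mulrC -scalerA ez.
  by rewrite !scalerA mulrC.
Qed.
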